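(* Assume $\mathit{Rid}$ and $\mathit{Lid}$ are infinite sets, and let $e$ be a program expression. If $e\downarrow s$ and $e\downarrow s'$, then $s\approx s'$.
   Context: Revision calculus. Fix sets $\mathit{Var}$, $\mathit{Rid}$ (revision identifiers), $\mathit{Lid}$ (location identifiers), and constants $\mathit{Const}\ni \mathsf{unit},\mathsf{true},\mathsf{false}$. Values $v ::= c \mid x \mid l \mid r \mid \lambda x.e$ and expressions $e ::= v \mid e\ e \mid e\ ?\ e : e \mid \mathsf{ref}\ e \mid !e \mid e := e \mid \mathsf{rfork}\ e \mid \mathsf{rjoin}\ e$ (syntax trees, no $\alpha$-equivalence). Evaluation contexts $\mathcal{E} ::= \square \mid \mathcal{E}\ e \mid v\ \mathcal{E} \mid \mathcal{E}\ ?\ e : e \mid \mathsf{ref}\ \mathcal{E} \mid !\mathcal{E} \mid \mathcal{E} := e \mid l := \mathcal{E} \mid \mathsf{rjoin}\ \mathcal{E}$; $\mathcal{E}[e]$ is plugging $e$ into the hole. Partial functions: $\epsilon$ is the empty partial function; $f(x\mapsto y)$ is update, $f(x\mapsto\bot)$ removes $x$ from the domain; $f :: g$ maps $x$ to $g\,x$ if $x\in\mathsf{dom}\,g$ and to $f\,x$ otherwise. A store is a partial function $\mathit{Lid}\rightharpoonup\mathit{Val}$; a local state is a triple $\langle\sigma,\tau,e\rangle$ of two stores and an expression. A global state is a partial function $s:\mathit{Rid}\rightharpoonup$ LocalState. Occurrences: $\mathit{RID}\ e$, $\mathit{LID}\ e$ are the sets of revision/location identifiers occurring in an expression; for a store $\mathit{RID}\,\sigma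 = \bigcup_{v\in\mathsf{ran}\,\sigma}\mathit{RID}\,v$ and $\mathit{LID}\,\sigma=\mathsf{dom}\,\sigma\cup\bigcup_{v\in\mathsf{ran}\,\sigma}\mathit{LID}\,v$; for a local state $\mathit{RID}\langle\sigma,\tau,e\rangle=\mathit{RID}\,\sigma\cup\mathit{RID}\,\tau\cup\mathit{RID}\,e$, likewise $\mathit{LID}$; for a global state $\mathit{RID}\,s=\mathsf{dom}\,s\cup\bigcup_{L\in\mathsf{ran}\,s}\mathit{RID}\,L$ and $\mathit{LID}\,s=\bigcup_{L\in\mathsf{ran}\,s}\mathit{LID}\,L$. Renaming: for $\alpha:\mathit{Rid}\to\mathit{Rid}$ and $\beta:\mathit{Lid}\to\mathit{Lid}$, $\mathcal{R}\,\alpha\,\beta\,S$ renames every revision identifier in a structure $S$ (value, expression, context) by $\alpha$ and every location identifier by $\beta$ (variables unchanged); for a store and bijective $\beta$, $(\mathcal{R}\,\alpha\,\beta\,\sigma)(\beta\,l)=\mathcal{R}\,\alpha\,\beta\,(\sigma\,l)$ (undefined iff $\sigma\,l$ undefined); local states are renamed componentwise; for a global state and bijective $\alpha$, $(\mathcal{R}\,\alpha\,\beta\,s)(\alpha\,r)=\mathcal{R}\,\alpha\,\beta\,(s\,r)$. $S\approx S'$ iff there are bijections $\alpha,\beta$ with $\mathcal{R}\,\alpha\,\beta\,S=S'$. Substitution: a fixed function $\mathsf{subst}$ with $[v/x]e := \mathsf{subst}\ v\ x\ e$, assumed only to satisfy $\mathcal{R}\,\alpha\,\beta\,(\mathsf{subst}\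 e\ x\ e')=\mathsf{subst}\,(\mathcal{R}\,\alpha\,\beta\,e)\,x\,(\mathcal{R}\,\alpha\,\beta\,e')$, $\mathit{RID}(\mathsf{subst}\ e\ x\ e')\subseteq\mathit{RID}\,e\cup\mathit{RID}\,e'$ and $\mathit{LID}(\mathsf{subst}\ e\ x\ e')\subseteq\mathit{LID}\,e\cup\mathit{LID}\,e'$. Transition relation $s\to_r s'$ (writing $s\llbracket r\mapsto L\rrbracket$ for ''a global state $s$ with $s\,r=L$''): (apply) $s\llbracket r\mapsto\langle\sigma,\tau,\mathcal{E}[(\lambda x.e)\,v]\rangle\rrbracket\to_r s(r\mapsto\langle\sigma,\tau,\mathcal{E}[[v/x]e]\rangle)$; (if-true) $\mathcal{E}[\mathsf{true}\ ?\ e_1:e_2]$ steps to $\mathcal{E}[e_1]$, (if-false) $\mathcal{E}[\mathsf{false}\ ?\ e_1:e_2]$ to $\mathcal{E}[e_2]$, stores unchanged; (new) $s\llbracket r\mapsto\langle\sigma,\tau,\mathcal{E}[\mathsf{ref}\,v]\rangle\rrbracket\to_r s(r\mapsto\langle\sigma,\tau(l\mapsto v),\mathcal{E}[l]\rangle)$ if $l\notin\mathit{LID}\,s$; (get) $s\llbracket r\mapsto\langle\sigma,\tau,\mathcal{E}[!l]\rangle\rrbracket\to_r s(r\mapsto\langle\sigma,\tau,\mathcal{E}[(\sigma::\tau)\,l]\rangle)$ if $l\in\mathsf{dom}(\sigma::\tau)$; (set) $s\llbracket r\mapsto\langle\sigma,\tau,\mathcal{E}[l:=v]\rangle\rrbracket\to_r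 s(r\mapsto\langle\sigma,\tau(l\mapsto v),\mathcal{E}[\mathsf{unit}]\rangle)$ if $l\in\mathsf{dom}(\sigma::\tau)$; (fork) $s\llbracket r\mapsto\langle\sigma,\tau,\mathcal{E}[\mathsf{rfork}\,e]\rangle\rrbracket\to_r s(r\mapsto\langle\sigma,\tau,\mathcal{E}[r']\rangle, r'\mapsto\langle\sigma::\tau,\epsilon,e\rangle)$ if $r'\notin\mathit{RID}\,s$; (join) if $s\,r=\langle\sigma,\tau,\mathcal{E}[\mathsf{rjoin}\,r']\rangle$ and $s\,r'=\langle\sigma',\tau',v\rangle$ with $v$ a value, then $s\to_r s(r\mapsto\langle\sigma,\tau::\tau',\mathcal{E}[\mathsf{unit}]\rangle, r'\mapsto\bot)$; (join$_\epsilon$) if $s\,r=\langle\sigma,\tau,\mathcal{E}[\mathsf{rjoin}\,r']\rangle$ and $r'\notin\mathsf{dom}\,s$, then $s\to_r\epsilon$. Let $\to=\bigcup_{r}\to_r$ and $\to^*$ its reflexive transitive closure. A program expression is an expression $e$ with $\mathit{RID}\,e=\mathit{LID}\,e=\varnothing$; an initial state for $e$ is $\epsilon(r\mapsto\langle\epsilon,\epsilon,e\rangle)$ for some $r\in\mathit{Rid}$. An execution is a sequence $s_0\to^* s$ from an initial state $s_0$; it is maximal if there is no $s''$ with $s\to s''$. For a program expression $e$, $e\downarrow s$ means that there is a maximal execution $s_0\to^* s$ with $s_0$ an initial state for $e$. *)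

(* Defs.v *)
From Stdlib Require Import ClassicalEpsilon FinFun Relations.

Set Implicit Arguments.
Unset Strict Implicit.

Definition pfun (X Y : Type) : Type := X -> option Y.

Section PartialFunctions.
Context {X Y : Type}.

Definition pempty : pfun X Y := fun _ => None.

Definition dom (f : pfun X Y) (x : X) : Prop := exists y, f x = Some y.

Definition ran (f : pfun X Y) (y : Y) : Prop := exists x, f x = Some y.

(* [oy = Some y] gives f(x |-> y), and [oy = None] gives f(x |-> bot). *)
Definition pset (f : pfun X Y) (x : X) (oy : option Y) : pfun X Y :=
  fun z => if excluded_middle_informative (z = x) then oy else f z.

Definition pupdate (f : pfun X Y) (x : X) (y : Y) : pfun X Y := pset f x (Some y).

Definition premove (f : pfun X Y) (x : X) : pfun X Y := pset f x None.

(* f :: g, the right operand taking precedence *)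
Definition poverride (f g : pfun X Y) : pfun X Y :=
  fun x => match g x with Some y => Some y | None => f x end.

(* Renaming the arguments by [h] and the results by [k].  It is only meant for
   bijective [h], where it is characterized by [prename_spec]. *)
Definition prename (h : X -> X) (k : Y -> Y) (f : pfun X Y) : pfun X Y :=
  fun z =>
    match excluded_middle_informative (exists x, h x = z) with
    | left H => option_map k (f (proj1_sig (constructive_indefinite_description _ H)))
    | right _ => None
    end.

Lemma prename_spec (h : X -> X) (k : Y -> Y) (f : pfun X Y) :
  Bijective h -> forall x, prename h k f (h x) = option_map k (f x).
Proof.
intros [g [gh hg]] x; unfold prename.
destruct (excluded_middle_informative (exists x0, h x0 = h x)) as [H|H].
- destruct (constructive_indefinite_description _ H) as [x0 Hx0]; simpl.
  now rewrite <- (gh x0), Hx0, gh.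
- now exfalso; apply H; exists x.
Qed.

End PartialFunctions.

Record constants : Type := Constants {
  const :> Type;
  c_unit : const;
  c_true : const;
  c_false : const;
  c_unit_true : c_unit <> c_true;
  c_unit_false : c_unit <> c_false;
  c_true_false : c_true <> c_false
}.

Section RevisionCalculus.
Context {Var Rid Lid : Type} {Const : constants}.

Inductive val : Type :=
| VConst (c : Const)
| VVar (x : Var)
| VLoc (l : Lid)
| VRid (r : Rid)
| VLam (x : Var) (e : expr)
with expr : Type :=
| EVal (v : val)
| EApp (e1 e2 : expr)
| EIf (e1 e2 e3 : expr)
| ERef (e : expr)
| EGet (e : expr)
| ESet (e1 e2 : expr)
| EFork (e : expr)
| EJoin (e : expr).

Inductive ectx : Type :=
| CHole
| CAppL (E : ectx) (e : expr)
| CAppR (v : val) (E : ectx)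
| CIf (E : ectx) (e1 e2 : expr)
| CRef (E : ectx)
| CGet (E : ectx)
| CSetL (E : ectx) (e : expr)
| CSetR (l : Lid) (E : ectx)
| CJoin (E : ectx).

Fixpoint plug (E : ectx) (e : expr) : expr :=
  match E with
  | CHole => e
  | CAppL E e2 => EApp (plug E e) e2
  | CAppR v E => EApp (EVal v) (plug E e)
  | CIf E e1 e2 => EIf (plug E e) e1 e2
  | CRef E => ERef (plug E e)
  | CGet E => EGet (plug E e)
  | CSetL E e2 => ESet (plug E e) e2
  | CSetR l E => ESet (EVal (VLoc l)) (plug E e)
  | CJoin E => EJoin (plug E e)
  end.

Definition store : Type := pfun Lid val.

Record lstate : Type := LState {
  snapshot : store;
  local : store;
  code : expr
}.

Definition gstate : Type := pfun Rid lstate.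

Fixpoint rid_val (v : val) (r : Rid) : Prop :=
  match v with
  | VConst _ | VVar _ | VLoc _ => False
  | VRid r' => r = r'
  | VLam _ e => rid_expr e r
  end
with rid_expr (e : expr) (r : Rid) : Prop :=
  match e with
  | EVal v => rid_val v r
  | EApp e1 e2 | ESet e1 e2 => rid_expr e1 r \/ rid_expr e2 r
  | EIf e1 e2 e3 => rid_expr e1 r \/ rid_expr e2 r \/ rid_expr e3 r
  | ERef e | EGet e | EFork e | EJoin e => rid_expr e r
  end.

Fixpoint lid_val (v : val) (l : Lid) : Prop :=
  match v with
  | VConst _ | VVar _ | VRid _ => False
  | VLoc l' => l = l'
  | VLam _ e => lid_expr e l
  end
with lid_expr (e : expr) (l : Lid) : Prop :=
  match e with
  | EVal v => lid_val v l
  | EApp e1 e2 | ESet e1 e2 => lid_expr e1 l \/ lid_expr e2 l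
  | EIf e1 e2 e3 => lid_expr e1 l \/ lid_expr e2 l \/ lid_expr e3 l
  | ERef e | EGet e | EFork e | EJoin e => lid_expr e l
  end.

Definition rid_store (sigma : store) (r : Rid) : Prop :=
  exists v, ran sigma v /\ rid_val v r.

Definition lid_store (sigma : store) (l : Lid) : Prop :=
  dom sigma l \/ exists v, ran sigma v /\ lid_val v l.

Definition rid_lstate (L : lstate) (r : Rid) : Prop :=
  rid_store (snapshot L) r \/ rid_store (local L) r \/ rid_expr (code L) r.

Definition lid_lstate (L : lstate) (l : Lid) : Prop :=
  lid_store (snapshot L) l \/ lid_store (local L) l \/ lid_expr (code L) l.

Definition rid_gstate (s : gstate) (r : Rid) : Prop :=
  dom s r \/ exists L, ran s L /\ rid_lstate L r.

Definition lid_gstate (s : gstate) (l : Lid) : Prop :=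
  exists L, ran s L /\ lid_lstate L l.

Section Renaming.
Context (alpha : Rid -> Rid) (beta : Lid -> Lid).

Fixpoint ren_val (v : val) : val :=
  match v with
  | VConst c => VConst c
  | VVar x => VVar x
  | VLoc l => VLoc (beta l)
  | VRid r => VRid (alpha r)
  | VLam x e => VLam x (ren_expr e)
  end
with ren_expr (e : expr) : expr :=
  match e with
  | EVal v => EVal (ren_val v)
  | EApp e1 e2 => EApp (ren_expr e1) (ren_expr e2)
  | EIf e1 e2 e3 => EIf (ren_expr e1) (ren_expr e2) (ren_expr e3)
  | ERef e => ERef (ren_expr e)
  | EGet e => EGet (ren_expr e)
  | ESet e1 e2 => ESet (ren_expr e1) (ren_expr e2)
  | EFork e => EFork (ren_expr e)
  | EJoin e => EJoin (ren_expr e)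
  end.

Definition ren_store (sigma : store) : store := prename beta ren_val sigma.

Definition ren_lstate (L : lstate) : lstate :=
  LState (ren_store (snapshot L)) (ren_store (local L)) (ren_expr (code L)).

Definition ren_gstate (s : gstate) : gstate := prename alpha ren_lstate s.

End Renaming.

Definition gequiv (s s' : gstate) : Prop :=
  exists (alpha : Rid -> Rid) (beta : Lid -> Lid),
    Bijective alpha /\ Bijective beta /\ ren_gstate alpha beta s = s'.

Definition unit_val : val := VConst (c_unit Const).
Definition true_val : val := VConst (c_true Const).
Definition false_val : val := VConst (c_false Const).

Section Semantics.
(* [subst e x e'] stands for [e/x]e'. *)
Context (subst : expr -> Var -> expr -> expr).

Inductive step_at (r : Rid) (s : gstate) : gstate -> Prop :=
| step_apply sigma tau E x e v :
    s r = Some (LState sigma tau (plug E (EApp (EVal (VLam x e)) (EVal v)))) ->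
    step_at r s (pupdate s r (LState sigma tau (plug E (subst (EVal v) x e))))
| step_if_true sigma tau E e1 e2 :
    s r = Some (LState sigma tau (plug E (EIf (EVal true_val) e1 e2))) ->
    step_at r s (pupdate s r (LState sigma tau (plug E e1)))
| step_if_false sigma tau E e1 e2 :
    s r = Some (LState sigma tau (plug E (EIf (EVal false_val) e1 e2))) ->
    step_at r s (pupdate s r (LState sigma tau (plug E e2)))
| step_new sigma tau E v l :
    s r = Some (LState sigma tau (plug E (ERef (EVal v)))) ->
    ~ lid_gstate s l ->
    step_at r s
      (pupdate s r (LState sigma (pupdate tau l v) (plug E (EVal (VLoc l)))))
| step_get sigma tau E l v :
    s r = Some (LState sigma tau (plug E (EGet (EVal (VLoc l))))) ->
    poverride sigma tau l = Some v ->
    step_at r s (pupdate s r (LState sigma tau (plug E (EVal v))))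
| step_set sigma tau E l v :
    s r = Some (LState sigma tau (plug E (ESet (EVal (VLoc l)) (EVal v)))) ->
    dom (poverride sigma tau) l ->
    step_at r s
      (pupdate s r (LState sigma (pupdate tau l v) (plug E (EVal unit_val))))
| step_fork sigma tau E e r' :
    s r = Some (LState sigma tau (plug E (EFork e))) ->
    ~ rid_gstate s r' ->
    step_at r s
      (pupdate (pupdate s r (LState sigma tau (plug E (EVal (VRid r')))))
         r' (LState (poverride sigma tau) pempty e))
| step_join sigma tau E r' sigma' tau' v :
    s r = Some (LState sigma tau (plug E (EJoin (EVal (VRid r'))))) ->
    s r' = Some (LState sigma' tau' (EVal v)) ->
    step_at r s
      (premove
         (pupdate s r (LState sigma (poverride tau tau') (plug E (EVal unit_val))))
         r')
| step_join_eps sigma tau E r' :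
    s r = Some (LState sigma tau (plug E (EJoin (EVal (VRid r'))))) ->
    ~ dom s r' ->
    step_at r s pempty.

Definition step (s s' : gstate) : Prop := exists r, step_at r s s'.

Definition steps : gstate -> gstate -> Prop := clos_refl_trans gstate step.

Definition program_expr (e : expr) : Prop :=
  (forall r, ~ rid_expr e r) /\ (forall l, ~ lid_expr e l).

Definition initial_state (e : expr) (s : gstate) : Prop :=
  exists r, s = pupdate pempty r (LState pempty pempty e).

Definition evaluates (e : expr) (s : gstate) : Prop :=
  exists s0, initial_state e s0 /\ steps s0 s /\ ~ (exists s'', step s s'').

End Semantics.

End RevisionCalculus.

Arguments val : clear implicits.
Arguments expr : clear implicits.
Arguments ectx : clear implicits.
Arguments store : clear implicits.
Arguments lstate : clear implicits.
Arguments gstate : clear implicits.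

(* Main.v *)
(** Fix the identifiers a step may allocate: then a step of a given revision is
    deterministic, because the decomposition of an expression into an evaluation
    context and a redex is unique.  Steps commute with renamings, so exchanging
    two fresh identifiers shows that a different choice of fresh identifiers
    only changes the result up to renaming.  Steps of two different revisions
    that allocate different identifiers can be joined by at most one further
    step on each side; the critical cases are two revisions joining the same
    revision and a failing join, where both sides reach the empty state.
    Hence the reduction is subcommutative modulo renaming, and normal forms are
    unique modulo renaming. *)

Require Import Defs.
From Stdlib Require Import FinFun ClassicalEpsilon FunctionalExtensionality
  Relations List.

Set Implicit Arguments.
Unset Strict Implicit.

(** * Partial functions and transpositions *)

Section PartialFunctionFacts.
Context {X Y : Type}.
Implicit Types (f g : pfun X Y) (x : X) (y : Y).

Lemma pset_same f x oy : pset f x oy x = oy.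
Proof. unfold pset; destruct excluded_middle_informative; congruence. Qed.

Lemma pset_other f x oy z : z <> x -> pset f x oy z = f z.
Proof. unfold pset; destruct excluded_middle_informative; congruence. Qed.

Lemma ran_pset f x oy y : ran (pset f x oy) y -> oy = Some y \/ ran f y.
Proof.
intros [z Hz]; unfold pset in Hz.
destruct excluded_middle_informative; [now left | right; now exists z].
Qed.

Lemma dom_pset f x oy z : dom (pset f x oy) z -> z = x \/ dom f z.
Proof.
intros [y Hy]; unfold pset in Hy.
destruct excluded_middle_informative; [now left | right; now exists y].
Qed.

Lemma ran_poverride f g y : ran (poverride f g) y -> ran f y \/ ran g y.
Proof.
intros [z Hz]; unfold poverride in Hz.
destruct (g z) eqn:E; [right | left]; exists z; congruence.
Qed.

Lemma dom_poverride f g x : dom (poverride f g) x -> dom f x \/ dom g x.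
Proof.
intros [y Hy]; unfold poverride in Hy.
destruct (g x) eqn:E; [right | left]; exists y; congruence.
Qed.

(** Since [h] is surjective, the values at the points [h x] determine the renamed function; the
    choice of preimages inside [prename] need not be unfolded. *)
Lemma prename_eq h k f g :
  Bijective h -> (forall x, g (h x) = option_map k (f x)) -> prename h k f = g.
Proof.
intros Hh Hg; extensionality z.
destruct Hh as [h' [h'h hh']].
rewrite <- (hh' z), Hg; apply prename_spec; now exists h'.
Qed.

Lemma prename_pset h k f x oy :
  Bijective h ->
  prename h k (pset f x oy) = pset (prename h k f) (h x) (option_map k oy).
Proof.
intros Hh; apply prename_eq; trivial; intros z; unfold pset at 2.
destruct excluded_middle_informative as [->|n]; [apply pset_same|].
rewrite pset_other, prename_spec; trivial.
destruct Hh as [h' [h'h _]]; congruence.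
Qed.

Lemma prename_poverride h k f g :
  Bijective h ->
  prename h k (poverride f g) = poverride (prename h k f) (prename h k g).
Proof.
intros Hh; apply prename_eq; trivial; intros z; unfold poverride.
rewrite !prename_spec by trivial; now destruct (g z).
Qed.

Lemma prename_pempty h k : Bijective h -> prename h k (@pempty X Y) = pempty.
Proof. intros Hh; now apply prename_eq. Qed.

Lemma prename_preimage h k f z y :
  Bijective h -> prename h k f z = Some y ->
  exists x y', z = h x /\ f x = Some y' /\ y = k y'.
Proof.
intros Hh Hz; assert (H := Hh); destruct H as [h' [_ hh']].
rewrite <- (hh' z), prename_spec in Hz by trivial.
destruct (f (h' z)) eqn:E; [|discriminate].
injection Hz as <-; eauto.
Qed.

End PartialFunctionFacts.

Section Transpositions.
Context {X : Type}.

Definition swap (a b x : X) : X :=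
  if excluded_middle_informative (x = a) then b
  else if excluded_middle_informative (x = b) then a else x.

Lemma swap_bij a b : Bijective (swap a b).
Proof.
exists (swap a b).
split; intros x; unfold swap;
  repeat destruct excluded_middle_informative; congruence.
Qed.

Lemma swap_left a b : swap a b a = b.
Proof. unfold swap; destruct excluded_middle_informative; congruence. Qed.

Lemma swap_other a b x : x <> a -> x <> b -> swap a b x = x.
Proof.
unfold swap; repeat destruct excluded_middle_informative; congruence.
Qed.

Lemma Bijective_inj (f : X -> X) x y : Bijective f -> f x = f y -> x = y.
Proof. intros [g [gf _]] H; now rewrite <- (gf x), H. Qed.

Lemma Bijective_comp (f g : X -> X) :
  Bijective f -> Bijective g -> Bijective (fun x => f (g x)).
Proof.
intros [f' [f1 f2]] [g' [g1 g2]].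
exists (fun x => g' (f' x)); split; intros x; congruence.
Qed.

(** Otherwise [l] itself enumerates the type and witnesses [Finite X]. *)
Lemma infinite_fresh (l : list X) : ~ Finite X -> exists x, ~ In x l.
Proof.
intros H; destruct (classic (exists x, ~ In x l)) as [?|n]; trivial.
elim H; exists l; intros x; apply NNPP; firstorder.
Qed.

End Transpositions.

Scheme val_mut_ind := Induction for val Sort Prop
with expr_mut_ind := Induction for expr Sort Prop.
Combined Scheme val_expr_mut_ind from val_mut_ind, expr_mut_ind.

Section Determinacy.
Context {Var Rid Lid : Type} {Const : constants}.

Notation Val := (val Var Rid Lid Const).
Notation Expr := (expr Var Rid Lid Const).
Notation Ectx := (ectx Var Rid Lid Const).
Notation Store := (store Var Rid Lid Const).
Notation Lstate := (lstate Var Rid Lid Const).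
Notation Gstate := (gstate Var Rid Lid Const).

(** * Unique decomposition *)

(** Only the shape counts: the values in active positions may be of the wrong kind, so stuck terms
    are included. [EFork] takes any operand because no context enters a fork. *)
Inductive redex : Expr -> Prop :=
| redex_app v w : redex (EApp (EVal v) (EVal w))
| redex_if v e1 e2 : redex (EIf (EVal v) e1 e2)
| redex_ref v : redex (ERef (EVal v))
| redex_get v : redex (EGet (EVal v))
| redex_set v w : redex (ESet (EVal v) (EVal w))
| redex_fork e : redex (EFork e)
| redex_join v : redex (EJoin (EVal v)).

Lemma plug_redex_not_val (E : Ectx) e v : redex e -> plug E e <> EVal v.
Proof. intros H; destruct E; simpl; try discriminate; now destruct H. Qed.

(** Induction on [E1], comparing outermost constructors. If the holes lie at different positions,
    some plugged redex would have to equal a value, against [plug_redex_not_val]. *)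
Lemma plug_redex_inj (E1 E2 : Ectx) e1 e2 :
  redex e1 -> redex e2 -> plug E1 e1 = plug E2 e2 -> E1 = E2 /\ e1 = e2.
Proof.
intros H1 H2; revert E2.
assert (Hv : forall (E : Ectx) e v, redex e -> EVal v <> plug E e)
  by (intros E e v He Heq; now apply (@plug_redex_not_val E e v He)).
induction E1; intros E2; destruct E2; simpl; intros Heq;
  try discriminate Heq; try (now split);
  try (exfalso; subst e1; inversion H1; eapply Hv; [|eassumption]; assumption);
  try (exfalso; subst e2; inversion H2; eapply Hv;
       [|eassumption || (symmetry; eassumption)]; assumption);
  injection Heq; intros; subst;
  try (exfalso; eapply plug_redex_not_val; [|eassumption]; eassumption);
  try (exfalso; eapply Hv; [|eassumption]; eassumption);
  match goal with
  | H : plug _ _ = plug _ _ |- _ => destruct (IHE1 _ H); subst; now split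
  end.
Qed.

(** * Renaming *)

Lemma ren_id_on_syntax (alpha : Rid -> Rid) (beta : Lid -> Lid) :
  (forall v : Val, (forall r, rid_val v r -> alpha r = r) ->
     (forall l, lid_val v l -> beta l = l) -> ren_val alpha beta v = v) /\
  (forall e : Expr, (forall r, rid_expr e r -> alpha r = r) ->
     (forall l, lid_expr e l -> beta l = l) -> ren_expr alpha beta e = e).
Proof. apply val_expr_mut_ind; simpl; intros; f_equal; auto. Qed.

Lemma ren_store_id_on alpha beta (sigma : Store) :
  Bijective beta ->
  (forall r, rid_store sigma r -> alpha r = r) ->
  (forall l, lid_store sigma l -> beta l = l) ->
  ren_store alpha beta sigma = sigma.
Proof.
intros Hb HR HL; apply prename_eq; trivial; intros l.
assert (Hval : forall l v, sigma l = Some v -> ren_val alpha beta v = v).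
{ intros l' v Hv; apply ren_id_on_syntax.
  - intros r Hr; apply HR; exists v; split; trivial; now exists l'.
  - intros l0 Hl; apply HL; right; exists v; split; trivial; now exists l'. }
destruct (sigma l) as [v|] eqn:Hv; simpl.
- now rewrite (HL l), (Hval l v) by (trivial; left; now exists v).
(* [sigma] is undefined at [l]. Were it defined at [beta l], then [beta] would fix [beta l], and
   injectivity would give [beta l = l], a contradiction. *)
- destruct (sigma (beta l)) as [v|] eqn:Hbl; trivial.
  assert (Hfix : beta (beta l) = beta l) by (apply HL; left; now exists v).
  apply (Bijective_inj Hb) in Hfix; congruence.
Qed.

Lemma ren_lstate_id_on alpha beta (L : Lstate) :
  Bijective beta ->
  (forall r, rid_lstate L r -> alpha r = r) ->
  (forall l, lid_lstate L l -> beta l = l) ->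
  ren_lstate alpha beta L = L.
Proof.
intros Hb HR HL; destruct L as [sigma tau e]; unfold ren_lstate; simpl.
unfold rid_lstate, lid_lstate in *; simpl in *.
rewrite !ren_store_id_on by auto.
f_equal; apply ren_id_on_syntax; auto.
Qed.

Lemma ren_gstate_id_on alpha beta (s : Gstate) :
  Bijective alpha -> Bijective beta ->
  (forall r, rid_gstate s r -> alpha r = r) ->
  (forall l, lid_gstate s l -> beta l = l) ->
  ren_gstate alpha beta s = s.
Proof.
intros Ha Hb HR HL; apply prename_eq; trivial; intros r.
destruct (s r) as [L|] eqn:Hs; simpl.
- rewrite (HR r), Hs by (left; now exists L).
  rewrite ren_lstate_id_on; trivial.
  + intros r' Hr'; apply HR; right; exists L; split; trivial; now exists r.
  + intros l Hl; apply HL; exists L; split; trivial; now exists r.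
- destruct (s (alpha r)) as [L|] eqn:Har; trivial.
  assert (Hfix : alpha (alpha r) = alpha r) by (apply HR; left; now exists L).
  apply (Bijective_inj Ha) in Hfix; congruence.
Qed.

Lemma ren_comp_syntax (a a' : Rid -> Rid) (b b' : Lid -> Lid) :
  (forall v : Val, ren_val a' b' (ren_val a b v) =
     ren_val (fun r => a' (a r)) (fun l => b' (b l)) v) /\
  (forall e : Expr, ren_expr a' b' (ren_expr a b e) =
     ren_expr (fun r => a' (a r)) (fun l => b' (b l)) e).
Proof. apply val_expr_mut_ind; simpl; intros; f_equal; auto. Qed.

Lemma ren_store_comp a a' b b' (sigma : Store) :
  Bijective b -> Bijective b' ->
  ren_store a' b' (ren_store a b sigma) =
  ren_store (fun r => a' (a r)) (fun l => b' (b l)) sigma.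
Proof.
intros Hb Hb'; symmetry; apply prename_eq; [now apply Bijective_comp|].
intros l; unfold ren_store; rewrite !prename_spec by trivial.
destruct (sigma l); simpl; trivial; f_equal; apply ren_comp_syntax.
Qed.

Lemma ren_gstate_comp a a' b b' (s : Gstate) :
  Bijective a -> Bijective a' -> Bijective b -> Bijective b' ->
  ren_gstate a' b' (ren_gstate a b s) =
  ren_gstate (fun r => a' (a r)) (fun l => b' (b l)) s.
Proof.
intros Ha Ha' Hb Hb'; symmetry; apply prename_eq; [now apply Bijective_comp|].
intros r; unfold ren_gstate; rewrite !prename_spec by trivial.
destruct (s r) as [[sigma tau e]|]; simpl; trivial; f_equal.
unfold ren_lstate; simpl; f_equal; try now apply ren_store_comp.
apply ren_comp_syntax.
Qed.

(** * Equality of global states up to renaming is an equivalence relation *)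

Lemma gequiv_refl (s : Gstate) : gequiv s s.
Proof.
assert (Hid : forall X : Type, Bijective (fun x : X => x))
  by (intros X; now exists (fun x => x)).
exists (fun r => r), (fun l => l); repeat split; trivial.
now apply ren_gstate_id_on.
Qed.

Lemma gequiv_trans (s t u : Gstate) : gequiv s t -> gequiv t u -> gequiv s u.
Proof.
intros [a [b [Ha [Hb <-]]]] [a' [b' [Ha' [Hb' <-]]]].
exists (fun r => a' (a r)), (fun l => b' (b l)).
repeat split; try now apply Bijective_comp.
symmetry; now apply ren_gstate_comp.
Qed.

Lemma gequiv_sym (s t : Gstate) : gequiv s t -> gequiv t s.
Proof.
intros [a [b [Ha [Hb <-]]]].
assert (Ha1 := Ha); destruct Ha1 as [a' [a'a aa']].
assert (Hb1 := Hb); destruct Hb1 as [b' [b'b bb']].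
assert (Ha' : Bijective a') by (exists a; now split).
assert (Hb' : Bijective b') by (exists b; now split).
exists a', b'; repeat split; trivial.
(* The composite with the inverses is pointwise the identity, so it fixes every identifier occurring
   in [s]. *)
rewrite ren_gstate_comp by trivial.
apply ren_gstate_id_on; auto using Bijective_comp.
Qed.

Section BijectiveRenaming.
Context (alpha : Rid -> Rid) (beta : Lid -> Lid).
Context (alpha_bij : Bijective alpha) (beta_bij : Bijective beta).

(** Contexts must be renamed too, so that [ren_plug] carries a decomposition into context and redex
    to one of the renamed expression. *)
Fixpoint ren_ectx (E : Ectx) : Ectx :=
  match E with
  | CHole => CHole
  | CAppL E e => CAppL (ren_ectx E) (ren_expr alpha beta e)
  | CAppR v E => CAppR (ren_val alpha beta v) (ren_ectx E)
  | CIf E e1 e2 =>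
      CIf (ren_ectx E) (ren_expr alpha beta e1) (ren_expr alpha beta e2)
  | CRef E => CRef (ren_ectx E)
  | CGet E => CGet (ren_ectx E)
  | CSetL E e => CSetL (ren_ectx E) (ren_expr alpha beta e)
  | CSetR l E => CSetR (beta l) (ren_ectx E)
  | CJoin E => CJoin (ren_ectx E)
  end.

Lemma ren_plug (E : Ectx) e :
  ren_expr alpha beta (plug E e) = plug (ren_ectx E) (ren_expr alpha beta e).
Proof. induction E; simpl; congruence. Qed.

(** Injectivity of [alpha] makes renaming reflect occurrences. Read contrapositively, and lifted to
    stores and states below, this says that renaming sends fresh identifiers to fresh ones. *)
Lemma rid_ren_syntax r :
  (forall v : Val, rid_val (ren_val alpha beta v) (alpha r) -> rid_val v r) /\
  (forall e : Expr, rid_expr (ren_expr alpha beta e) (alpha r) -> rid_expr e r).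
Proof.
apply val_expr_mut_ind; simpl; intros; try tauto.
now apply (Bijective_inj alpha_bij).
Qed.

Lemma lid_ren_syntax l :
  (forall v : Val, lid_val (ren_val alpha beta v) (beta l) -> lid_val v l) /\
  (forall e : Expr, lid_expr (ren_expr alpha beta e) (beta l) -> lid_expr e l).
Proof.
apply val_expr_mut_ind; simpl; intros; try tauto.
now apply (Bijective_inj beta_bij).
Qed.

Lemma rid_ren_store (sigma : Store) r :
  rid_store (ren_store alpha beta sigma) (alpha r) -> rid_store sigma r.
Proof.
intros [v [[l Hl] Hr]].
apply prename_preimage in Hl as [l' [v' [-> [Hl ->]]]]; trivial.
exists v'; split; [now exists l' | now apply rid_ren_syntax].
Qed.

Lemma lid_ren_store (sigma : Store) l :
  lid_store (ren_store alpha beta sigma) (beta l) -> lid_store sigma l.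
Proof.
intros [[v Hv]|[v [[l0 Hl] Hr]]].
- apply prename_preimage in Hv as [l' [v' [Heq [Hl ->]]]]; trivial.
  apply (Bijective_inj beta_bij) in Heq as ->; left; now exists v'.
- apply prename_preimage in Hl as [l' [v' [-> [Hl ->]]]]; trivial.
  right; exists v'; split; [now exists l' | now apply lid_ren_syntax].
Qed.

Lemma rid_ren_gstate (s : Gstate) r :
  rid_gstate (ren_gstate alpha beta s) (alpha r) -> rid_gstate s r.
Proof.
intros [[L HL]|[L [[r0 Hr0] Hr]]].
- apply prename_preimage in HL as [r' [L' [Heq [HL ->]]]]; trivial.
  apply (Bijective_inj alpha_bij) in Heq as ->; left; now exists L'.
- apply prename_preimage in Hr0 as [r' [L' [-> [HL ->]]]]; trivial.
  right; exists L'; split; [now exists r'|].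
  destruct Hr as [Hr|[Hr|Hr]].
  + left; now apply rid_ren_store.
  + right; left; now apply rid_ren_store.
  + right; right; now apply rid_ren_syntax.
Qed.

Lemma lid_ren_gstate (s : Gstate) l :
  lid_gstate (ren_gstate alpha beta s) (beta l) -> lid_gstate s l.
Proof.
intros [L [[r0 Hr0] Hl]].
apply prename_preimage in Hr0 as [r' [L' [-> [HL ->]]]]; trivial.
exists L'; split; [now exists r'|].
destruct Hl as [Hl|[Hl|Hl]].
- left; now apply lid_ren_store.
- right; left; now apply lid_ren_store.
- right; right; now apply lid_ren_syntax.
Qed.

Lemma ren_gstate_at (s : Gstate) r :
  ren_gstate alpha beta s (alpha r) = option_map (ren_lstate alpha beta) (s r).
Proof. now apply prename_spec. Qed.

End BijectiveRenaming.

(** * Occurring identifiers *)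

Section Occurrences.
Context (P : Prop) (E : Ectx) (e e' : Expr).

(** [P] collects the sources other than the redex: when [e] is contracted to [e'], an identifier may
    also come from a store or be newly allocated. *)
Lemma rid_plug_mono r :
  (rid_expr e' r -> rid_expr e r \/ P) ->
  rid_expr (plug E e') r -> rid_expr (plug E e) r \/ P.
Proof. induction E; simpl; tauto. Qed.

Lemma lid_plug_mono l :
  (lid_expr e' l -> lid_expr e l \/ P) ->
  lid_expr (plug E e') l -> lid_expr (plug E e) l \/ P.
Proof. induction E; simpl; tauto. Qed.

Lemma rid_plug_hole r : rid_expr e r -> rid_expr (plug E e) r.
Proof. induction E; simpl; tauto. Qed.

Lemma lid_plug_hole l : lid_expr e l -> lid_expr (plug E e) l.
Proof. induction E; simpl; tauto. Qed.

End Occurrences.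

Lemma rid_store_pupdate (sigma : Store) l v r :
  rid_store (pupdate sigma l v) r -> rid_val v r \/ rid_store sigma r.
Proof.
intros [w [Hw Hr]]; apply ran_pset in Hw as [[= <-]|Hw]; [now left|].
right; now exists w.
Qed.

Lemma lid_store_pupdate (sigma : Store) l v l' :
  lid_store (pupdate sigma l v) l' ->
  l' = l \/ lid_val v l' \/ lid_store sigma l'.
Proof.
intros [Hd|[w [Hw Hr]]].
- apply dom_pset in Hd as [->|Hd]; [now left | right; right; now left].
- apply ran_pset in Hw as [[= <-]|Hw]; [now right; left|].
  right; right; right; now exists w.
Qed.

Lemma rid_store_poverride (sigma tau : Store) r :
  rid_store (poverride sigma tau) r -> rid_store sigma r \/ rid_store tau r.
Proof.
intros [w [Hw Hr]].
apply ran_poverride in Hw as [Hw|Hw]; [left|right]; now exists w.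
Qed.

Lemma lid_store_poverride (sigma tau : Store) l :
  lid_store (poverride sigma tau) l -> lid_store sigma l \/ lid_store tau l.
Proof.
intros [Hd|[w [Hw Hr]]].
- apply dom_poverride in Hd as [Hd|Hd]; [left|right]; now left.
- apply ran_poverride in Hw as [Hw|Hw]; [left|right]; right; now exists w.
Qed.

Lemma rid_store_pempty r : ~ rid_store (pempty : Store) r.
Proof. intros [w [[l Hl] _]]; discriminate. Qed.

Lemma lid_store_pempty l : ~ lid_store (pempty : Store) l.
Proof. intros [[w Hw]|[w [[l' Hl] _]]]; discriminate. Qed.

Lemma rid_gstate_pset (s : Gstate) r oL x :
  rid_gstate (pset s r oL) x ->
  oL <> None /\ x = r \/ (exists L, oL = Some L /\ rid_lstate L x) \/
  rid_gstate s x.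
Proof.
intros [[L HL]|[L [HL Hx]]].
- unfold pset in HL; destruct excluded_middle_informative.
  + left; split; congruence.
  + right; right; left; now exists L.
- apply ran_pset in HL as [->|HL].
  + right; left; now exists L.
  + right; right; right; now exists L.
Qed.

Lemma lid_gstate_pset (s : Gstate) r oL x :
  lid_gstate (pset s r oL) x ->
  (exists L, oL = Some L /\ lid_lstate L x) \/ lid_gstate s x.
Proof.
intros [L [HL Hx]].
apply ran_pset in HL as [->|HL]; [left | right]; now exists L.
Qed.

Lemma rid_gstate_at (s : Gstate) r L x :
  s r = Some L -> rid_lstate L x -> rid_gstate s x.
Proof. intros; right; exists L; split; trivial; now exists r. Qed.

Lemma lid_gstate_at (s : Gstate) r L x :
  s r = Some L -> lid_lstate L x -> lid_gstate s x.
Proof. intros; exists L; split; trivial; now exists r. Qed.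

(** * Steps with explicit fresh identifiers *)

Context (subst : Expr -> Var -> Expr -> Expr).
Context
  (subst_ren : forall (alpha : Rid -> Rid) (beta : Lid -> Lid) e x e',
     ren_expr alpha beta (subst e x e') =
     subst (ren_expr alpha beta e) x (ren_expr alpha beta e'))
  (subst_rid : forall e x e' r,
     rid_expr (subst e x e') r -> rid_expr e r \/ rid_expr e' r)
  (subst_lid : forall e x e' l,
     lid_expr (subst e x e') l -> lid_expr e l \/ lid_expr e' l).

(* In [AJoin j L] the local store of [j] is still to be merged into that of [L]. *)
Inductive action : Type :=
| ALocal (L : Lstate)
| AFork (L child : Lstate)
| AJoin (j : Rid) (L : Lstate).

(* [lact l0 r0 L a]: a revision in local state [L] can perform [a], allocating
   [l0] if it creates a location and [r0] if it forks. *)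
Inductive lact (l0 : Lid) (r0 : Rid) : Lstate -> action -> Prop :=
| lact_apply sigma tau E x e v :
    lact l0 r0 (LState sigma tau (plug E (EApp (EVal (VLam x e)) (EVal v))))
      (ALocal (LState sigma tau (plug E (subst (EVal v) x e))))
| lact_if_true sigma tau E e1 e2 :
    lact l0 r0 (LState sigma tau (plug E (EIf (EVal true_val) e1 e2)))
      (ALocal (LState sigma tau (plug E e1)))
| lact_if_false sigma tau E e1 e2 :
    lact l0 r0 (LState sigma tau (plug E (EIf (EVal false_val) e1 e2)))
      (ALocal (LState sigma tau (plug E e2)))
| lact_new sigma tau E v :
    lact l0 r0 (LState sigma tau (plug E (ERef (EVal v))))
      (ALocal (LState sigma (pupdate tau l0 v) (plug E (EVal (VLoc l0)))))
| lact_get sigma tau E l v :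
    poverride sigma tau l = Some v ->
    lact l0 r0 (LState sigma tau (plug E (EGet (EVal (VLoc l)))))
      (ALocal (LState sigma tau (plug E (EVal v))))
| lact_set sigma tau E l v :
    dom (poverride sigma tau) l ->
    lact l0 r0 (LState sigma tau (plug E (ESet (EVal (VLoc l)) (EVal v))))
      (ALocal (LState sigma (pupdate tau l v) (plug E (EVal unit_val))))
| lact_fork sigma tau E e :
    lact l0 r0 (LState sigma tau (plug E (EFork e)))
      (AFork (LState sigma tau (plug E (EVal (VRid r0))))
         (LState (poverride sigma tau) pempty e))
| lact_join sigma tau E j :
    lact l0 r0 (LState sigma tau (plug E (EJoin (EVal (VRid j)))))
      (AJoin j (LState sigma tau (plug E (EVal unit_val)))).

(** [step_at] with the allocated identifiers turned into parameters, chosen before it is known which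
    rule applies. Freshness is a separate condition; under it, [pstep_step_at] and [step_at_pstep]
    relate the two relations. *)
Inductive pstep (l0 : Lid) (r0 r : Rid) (s t : Gstate) : Prop :=
| pstep_local L L' :
    s r = Some L -> lact l0 r0 L (ALocal L') ->
    t = pupdate s r L' -> pstep l0 r0 r s t
| pstep_fork L L' child :
    s r = Some L -> lact l0 r0 L (AFork L' child) ->
    t = pupdate (pupdate s r L') r0 child -> pstep l0 r0 r s t
| pstep_join L j sigma tau e sigma' tau' v :
    s r = Some L -> lact l0 r0 L (AJoin j (LState sigma tau e)) ->
    s j = Some (LState sigma' tau' (EVal v)) ->
    t = premove (pupdate s r (LState sigma (poverride tau tau') e)) j ->
    pstep l0 r0 r s t
| pstep_eps L j L' :
    s r = Some L -> lact l0 r0 L (AJoin j L') -> s j = None ->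
    t = pempty -> pstep l0 r0 r s t.

Definition fresh (s : Gstate) (l0 : Lid) (r0 : Rid) : Prop :=
  ~ lid_gstate s l0 /\ ~ rid_gstate s r0.

Lemma pstep_step_at l0 r0 r s t :
  fresh s l0 r0 -> pstep l0 r0 r s t -> step_at subst r s t.
Proof.
intros [Hl Hr] [L L' Hs Hact ->|L L' c Hs Hact ->
  |L j sigma tau e sigma' tau' v Hs Hact Hj ->|L j L' Hs Hact Hj ->];
  inversion Hact; subst.
- now apply step_apply.
- now eapply step_if_true; eassumption.
- now eapply step_if_false; eassumption.
- now eapply step_new.
- eapply step_get; eassumption.
- eapply step_set; eassumption.
- now eapply step_fork.
- eapply step_join; eassumption.
- eapply step_join_eps; [eassumption|]; intros [? ?]; congruence.
Qed.

(** Unique decomposition forces the same context and redex, and with the allocated identifiers fixed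
    the redex determines the action. *)
Lemma lact_det l0 r0 L a a' : lact l0 r0 L a -> lact l0 r0 L a' -> a = a'.
Proof.
destruct 1; intros Hact; inversion Hact; subst;
  match goal with
  | H : plug _ _ = plug _ _ |- _ =>
      apply plug_redex_inj in H as [-> Heq]; [|constructor..]
  end;
  try discriminate Heq; try (injection Heq; intros; subst);
  (* The two conditional rules share their redex shape and are told apart by their distinct
     constants. *)
  try (elim (@c_true_false Const); congruence); congruence.
Qed.

(** Hence a revision that is ready to be joined cannot act, and in particular is neither of two
    revisions that are stepping. *)
Lemma value_no_lact l0 r0 sigma tau v a :
  ~ lact l0 r0 (LState sigma tau (EVal v)) a.
Proof.
intros Hact; inversion Hact; subst;
  (eapply plug_redex_not_val; [|eassumption]; constructor).
Qed.

(** The action is unique by [lact_det]; for a join, the entry of [s] at the joined revision decides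
    between success and failure. *)
Lemma pstep_det l0 r0 r s t t' :
  pstep l0 r0 r s t -> pstep l0 r0 r s t' -> t = t'.
Proof.
destruct 1; destruct 1; subst;
  match goal with
  | H : s r = Some ?L, H' : s r = Some ?L' |- _ =>
      rewrite H in H'; injection H' as <-
  end;
  match goal with
  | H : lact _ _ ?L ?a, H' : lact _ _ ?L ?a' |- _ =>
      assert (Ha := lact_det H H'); try discriminate Ha; injection Ha; intros
  end; congruence.
Qed.

(** * Equivariance of steps under renaming *)

Definition ren_action alpha beta (a : action) : action :=
  match a with
  | ALocal L => ALocal (ren_lstate alpha beta L)
  | AFork L c => AFork (ren_lstate alpha beta L) (ren_lstate alpha beta c)
  | AJoin j L => AJoin (alpha j) (ren_lstate alpha beta L)
  end.

Lemma lact_ren alpha beta l0 r0 L a :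
  Bijective beta -> lact l0 r0 L a ->
  lact (beta l0) (alpha r0) (ren_lstate alpha beta L) (ren_action alpha beta a).
Proof.
intros Hb; destruct 1; unfold ren_action, ren_lstate, ren_store, pupdate; simpl;
  rewrite ?ren_plug, ?prename_pset, ?prename_poverride, ?prename_pempty by trivial;
  simpl; rewrite ?subst_ren; try (now constructor).
- apply lact_get.
  now rewrite <- prename_poverride, prename_spec, H.
- apply lact_set.
  rewrite <- prename_poverride by trivial; destruct H as [w Hw].
  exists (ren_val alpha beta w); now rewrite prename_spec, Hw.
Qed.

Lemma pstep_ren alpha beta l0 r0 r s t :
  Bijective alpha -> Bijective beta -> pstep l0 r0 r s t ->
  pstep (beta l0) (alpha r0) (alpha r)
    (ren_gstate alpha beta s) (ren_gstate alpha beta t).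
Proof.
intros Ha Hb.
(* Stated for an optional local state, so that it also transports the absence of the joined revision
   in a failing join. *)
assert (Hat : forall r oL, s r = oL -> ren_gstate alpha beta s (alpha r) =
  option_map (ren_lstate alpha beta) oL)
  by (intros r1 oL <-; now apply ren_gstate_at).
destruct 1; subst; unfold pupdate, premove, ren_gstate;
  rewrite ?prename_pset, ?prename_pempty by trivial; fold (ren_gstate alpha beta s);
  apply Hat in H; apply (lact_ren alpha Hb) in H0; simpl in *.
- eapply pstep_local; eauto.
- eapply pstep_fork; eauto.
- apply Hat in H1; simpl in H1.
  eapply pstep_join; [exact H|exact H0|exact H1|].
  unfold ren_lstate, ren_store; simpl; now rewrite prename_poverride.
- apply Hat in H1; simpl in H1.
  eapply pstep_eps; eauto.
Qed.

(** * Identifiers that a step can introduce *)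

Definition rid_action (a : action) (x : Rid) : Prop :=
  match a with
  | ALocal L => rid_lstate L x
  | AFork L c => rid_lstate L x \/ rid_lstate c x
  | AJoin j L => x = j \/ rid_lstate L x
  end.

Definition lid_action (a : action) (x : Lid) : Prop :=
  match a with
  | ALocal L | AJoin _ L => lid_lstate L x
  | AFork L c => lid_lstate L x \/ lid_lstate c x
  end.

(** Everything in the new local states comes from the old code or stores, except the allocated
    identifier; for application this rests on [subst_rid]. *)
Lemma lact_rid l0 r0 L a x :
  lact l0 r0 L a -> rid_action a x -> rid_lstate L x \/ x = r0.
Proof.
destruct 1; unfold rid_action, rid_lstate; simpl; intros Hx;
  repeat match goal with H : _ \/ _ |- _ => destruct H as [H|H] end;
  repeat match goal with
  | H : rid_store (pupdate _ _ _) _ |- _ => apply rid_store_pupdate in H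
  | H : rid_store (poverride _ _) _ |- _ => apply rid_store_poverride in H
  | H : rid_store pempty _ |- _ => now apply rid_store_pempty in H
  | H : rid_expr (plug ?E ?e') ?x |- context [rid_expr (plug ?E ?e) ?x] =>
      first [constr_eq e e'; fail 1 |
      apply (@rid_plug_mono (rid_store sigma x \/ rid_store tau x \/ x = r0)
               E e e') in H; [tauto|clear H; simpl; intros Hx]]
  end;
  try (match goal with |- context [rid_expr (plug ?E ?e) ?x] =>
         assert (rid_expr e x -> rid_expr (plug E e) x)
           by apply rid_plug_hole end; simpl in *; tauto).
all: try tauto.
all: try (apply subst_rid in Hx; simpl in *; tauto).
(* The case left is a read: the value read lies in the range of the combined store. *)
assert (Hv : rid_store (poverride sigma tau) x)
  by (exists v; split; trivial; now exists l).
apply rid_store_poverride in Hv; tauto.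
Qed.

Lemma lact_lid l0 r0 L a x :
  lact l0 r0 L a -> lid_action a x -> lid_lstate L x \/ x = l0.
Proof.
destruct 1; unfold lid_action, lid_lstate; simpl; intros Hx;
  repeat match goal with H : _ \/ _ |- _ => destruct H as [H|H] end;
  repeat match goal with
  | H : lid_store (pupdate _ _ _) _ |- _ => apply lid_store_pupdate in H
  | H : lid_store (poverride _ _) _ |- _ => apply lid_store_poverride in H
  | H : lid_store pempty _ |- _ => now apply lid_store_pempty in H
  | H : lid_expr (plug ?E ?e') ?x |- context [lid_expr (plug ?E ?e) ?x] =>
      first [constr_eq e e'; fail 1 |
      apply (@lid_plug_mono (lid_store sigma x \/ lid_store tau x \/ x = l0)
               E e e') in H; [tauto|clear H; simpl; intros Hx]]
  end;
  try (match goal with |- context [lid_expr (plug ?E ?e) ?x] =>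
         assert (lid_expr e x -> lid_expr (plug E e) x)
           by apply lid_plug_hole end; simpl in *; tauto).
all: try tauto.
all: try (apply subst_lid in Hx; simpl in *; tauto).
assert (Hv : lid_store (poverride sigma tau) x)
  by (right; exists v; split; trivial; now exists l).
apply lid_store_poverride in Hv; tauto.
Qed.

Lemma pstep_rid l0 r0 r s t x :
  pstep l0 r0 r s t -> rid_gstate t x -> rid_gstate s x \/ x = r0.
Proof.
intros Hstep.
assert (Hact : forall L a, s r = Some L -> lact l0 r0 L a -> rid_action a x ->
                 rid_gstate s x \/ x = r0).
{ intros L a Hs Ha Hx; destruct (lact_rid Ha Hx); [left|now right].
  eapply rid_gstate_at; eassumption. }
assert (Hr : forall L, s r = Some L -> rid_gstate s r)
  by (intros L ?; left; now exists L).
destruct Hstep as [L L' Hs Ha ->|L L' c Hs Ha ->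
  |L j sigma tau e sigma' tau' v Hs Ha Hj ->|L j L' Hs Ha Hj ->]; intros Hx;
  specialize (Hact _ _ Hs Ha); simpl in Hact; specialize (Hr _ Hs);
  repeat match goal with
  | H : rid_gstate (pset _ _ _) _ |- _ =>
      apply rid_gstate_pset in H
  | H : rid_gstate (pupdate _ _ _) _ |- _ =>
      apply rid_gstate_pset in H
  | H : rid_gstate (premove _ _) _ |- _ =>
      apply rid_gstate_pset in H
  | H : _ \/ _ |- _ => destruct H as [H|H]
  | H : exists _, _ |- _ => destruct H as [? [[= <-] H]]
  | H : _ /\ _ |- _ => destruct H as [_ ->]
  end; auto.
(* In a successful join, the merged store may also contribute identifiers from the local store of
   [j], which already occur in [s]. *)
- destruct Hx as [Hx|[Hx|Hx]]; [apply Hact; right; now left| |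
    apply Hact; right; right; now right].
  apply rid_store_poverride in Hx as [Hx|Hx]; [apply Hact; right; right; now left|].
  left; eapply rid_gstate_at; [exact Hj|right; now left].
- destruct Hx as [[? ?]|[? [[? ?] _]]]; discriminate.
Qed.

Lemma pstep_lid l0 r0 r s t x :
  pstep l0 r0 r s t -> lid_gstate t x -> lid_gstate s x \/ x = l0.
Proof.
intros Hstep.
assert (Hact : forall L a, s r = Some L -> lact l0 r0 L a -> lid_action a x ->
                 lid_gstate s x \/ x = l0).
{ intros L a Hs Ha Hx; destruct (lact_lid Ha Hx); [left|now right].
  eapply lid_gstate_at; eassumption. }
destruct Hstep as [L L' Hs Ha ->|L L' c Hs Ha ->
  |L j sigma tau e sigma' tau' v Hs Ha Hj ->|L j L' Hs Ha Hj ->]; intros Hx;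
  specialize (Hact _ _ Hs Ha); simpl in Hact;
  repeat match goal with
  | H : lid_gstate (pset _ _ _) _ |- _ =>
      apply lid_gstate_pset in H
  | H : lid_gstate (pupdate _ _ _) _ |- _ =>
      apply lid_gstate_pset in H
  | H : lid_gstate (premove _ _) _ |- _ =>
      apply lid_gstate_pset in H
  | H : _ \/ _ |- _ => destruct H as [H|H]
  | H : exists _, _ |- _ => destruct H as [? [[= <-] H]]
  end; auto.
- destruct Hx as [Hx|[Hx|Hx]]; [apply Hact; now left| |
    apply Hact; right; now right].
  apply lid_store_poverride in Hx as [Hx|Hx]; [apply Hact; right; now left|].
  left; eapply lid_gstate_at; [exact Hj|right; now left].
- destruct Hx as [? [[? ?] _]]; discriminate.
Qed.

Lemma fresh_pstep l0 r0 l1 r1 r s t :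
  pstep l0 r0 r s t -> fresh s l1 r1 -> l1 <> l0 -> r1 <> r0 -> fresh t l1 r1.
Proof.
intros Ht [Hl Hr] Nl Nr; split; intros Hx.
- now destruct (pstep_lid Ht Hx).
- now destruct (pstep_rid Ht Hx).
Qed.

(** The transpositions of the two fresh choices move only identifiers absent from [s], hence fix
    [s]; by equivariance they carry the given step to one with the other choice. *)
Lemma pstep_refresh l0 r0 l1 r1 r s t :
  fresh s l0 r0 -> fresh s l1 r1 -> pstep l0 r0 r s t ->
  exists t', pstep l1 r1 r s t' /\ gequiv t t'.
Proof.
intros [Hl0 Hr0] [Hl1 Hr1] Ht.
exists (ren_gstate (swap r0 r1) (swap l0 l1) t); split;
  [|now exists (swap r0 r1), (swap l0 l1); repeat split; try apply swap_bij].
(* [r] occurs in [s], so it differs from both swapped identifiers and the stepping revision is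
   unchanged. *)
assert (Hr : rid_gstate s r) by (destruct Ht as [L|L|L|L]; left; now exists L).
apply (pstep_ren (swap_bij r0 r1) (swap_bij l0 l1)) in Ht.
rewrite !swap_left, swap_other, ren_gstate_id_on in Ht; trivial;
  try apply swap_bij; intros; try apply swap_other; congruence.
Qed.

(** * Subcommutativity modulo renaming *)

Definition step_or_eq (s t : Gstate) : Prop := s = t \/ step subst s t.

(** The common state is literally equal on both sides: renaming is dealt with beforehand, by making
    the two allocations differ. *)
Definition joinable (a b : Gstate) : Prop :=
  exists c, step_or_eq a c /\ step_or_eq b c.

Lemma pstep_step l0 r0 r s t :
  fresh s l0 r0 -> pstep l0 r0 r s t -> step subst s t.
Proof. intros Hf Ht; exists r; eapply pstep_step_at; eassumption. Qed.

(** A step of [q] cannot create [j], which occurs in the code of [r] and so is not fresh. Thus [r]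
    can still fail its join afterwards, unless the step of [q] has already led to the empty
    state. *)
Lemma failing_join_stable l0 r0 l1 r1 r q s L j L' b :
  r <> q -> fresh s l0 r0 -> fresh s l1 r1 -> l0 <> l1 -> r0 <> r1 ->
  s r = Some L -> lact l0 r0 L (AJoin j L') -> s j = None ->
  pstep l1 r1 q s b -> step_or_eq b pempty.
Proof.
intros Nrq F0 F1 Nl Nr Hr Hact Hj Hb.
assert (F0' := fresh_pstep Hb F0 Nl Nr).
destruct F1 as [_ F1].
assert (Nr1 : r <> r1)
  by (intros ->; apply F1; left; now exists L).
assert (Nj1 : j <> r1).
{ intros ->; apply F1; eapply rid_gstate_at; [exact Hr|].
  now inversion Hact; subst; right; right; apply rid_plug_hole. }
assert (Njq : j <> q) by (intros ->; destruct Hb; congruence).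
assert (Heps : b r = Some L -> b j = None -> step subst b pempty).
{ intros Hbr Hbj; apply (pstep_step F0' (r := r)).
  now eapply pstep_eps; eauto. }
destruct Hb as [M M' Hs Ha ->|M M' c Hs Ha ->
  |M k sigma tau e sigma' tau' v Hs Ha Hk ->|M k M' Hs Ha Hk ->].
- right; apply Heps; unfold pupdate; now rewrite pset_other.
- right; apply Heps; unfold pupdate; now rewrite !pset_other.
(* The revision joined by [q] holds a value, whereas [r] can act. *)
- assert (Nkr : r <> k).
  { intros ->; rewrite Hk in Hr; injection Hr as <-; now apply value_no_lact in Hact. }
  assert (Nkj : j <> k) by congruence.
  right; apply Heps; unfold premove, pupdate; now rewrite !pset_other.
- now left.
Qed.

(** If either step is a failing join, both sides reach the empty state. Otherwise a step depends
    only on its own revision and, for a join, on a finished one, so the steps interfere only when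
    both join the same revision. *)
Lemma pstep_commute l0 r0 l1 r1 r q s a b :
  r <> q -> fresh s l0 r0 -> fresh s l1 r1 -> l0 <> l1 -> r0 <> r1 ->
  pstep l0 r0 r s a -> pstep l1 r1 q s b -> joinable a b.
Proof.
intros Nrq F0 F1 Nl Nr Ha Hb.
assert (F0' := fresh_pstep Hb F0 Nl Nr).
assert (F1' := fresh_pstep Ha F1 (not_eq_sym Nl) (not_eq_sym Nr)).
assert (Hd : forall l0 r0 x, fresh s l0 r0 -> dom s x -> x <> r0)
  by (intros l r' x [_ F] Hx ->; now apply F; left).
assert (Hcommute : forall c, pstep l1 r1 q a c -> pstep l0 r0 r b c -> joinable a b).
{ intros c Hac Hbc; exists c; split; right; eapply pstep_step; eassumption. }
assert (Hval : forall l0 r0 r j L act M,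
  s r = Some L -> lact l0 r0 L act -> s j = Some M -> (exists v, code M = EVal v) ->
  r <> j).
{ intros l r' x j L act [sigma tau e] Hx Hact Hj [v Hv] ->; simpl in Hv; subst.
  rewrite Hj in Hx; injection Hx as <-; now apply value_no_lact in Hact. }
destruct Ha as [L L' Hr HL Ea|L L' c Hr HL Ea
  |L j sigma tau e sigma' tau' v Hr HL Hj Ea|L j L' Hr HL Hj Ea];
[| | |exists pempty; split; [now left|
  exact (failing_join_stable Nrq F0 F1 Nl Nr Hr HL Hj Hb)]];
(destruct Hb as [M M' Hq HM Eb|M M' d Hq HM Eb
  |M k rho ups f rho' ups' w Hq HM Hk Eb|M k M' Hq HM Hk Eb];
[| | |exists pempty; split; [|now left];
  apply (failing_join_stable (not_eq_sym Nrq) F1 F0 (not_eq_sym Nl)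
           (not_eq_sym Nr) Hq HM Hk); econstructor; eassumption]).
all: assert (Nr0 : r <> r0) by (eapply Hd; [exact F0|eexists; exact Hr]).
all: assert (Nr1 : r <> r1) by (eapply Hd; [exact F1|eexists; exact Hr]).
all: assert (Nq0 : q <> r0) by (eapply Hd; [exact F0|eexists; exact Hq]).
all: assert (Nq1 : q <> r1) by (eapply Hd; [exact F1|eexists; exact Hq]).
all: try (assert (Nj0 : j <> r0) by (eapply Hd; [exact F0|eexists; exact Hj]);
          assert (Nj1 : j <> r1) by (eapply Hd; [exact F1|eexists; exact Hj]);
          assert (Nrj : r <> j)
            by (apply (Hval _ _ _ _ _ _ _ Hr HL Hj); eexists; reflexivity);
          assert (Nqj : q <> j)
            by (apply (Hval _ _ _ _ _ _ _ Hq HM Hj); eexists; reflexivity)).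
all: try (assert (Nk0 : k <> r0) by (eapply Hd; [exact F0|eexists; exact Hk]);
          assert (Nk1 : k <> r1) by (eapply Hd; [exact F1|eexists; exact Hk]);
          assert (Nrk : r <> k)
            by (apply (Hval _ _ _ _ _ _ _ Hr HL Hk); eexists; reflexivity);
          assert (Nqk : q <> k)
            by (apply (Hval _ _ _ _ _ _ _ Hq HM Hk); eexists; reflexivity)).
(* Both join the same revision: whichever goes second finds it removed and fails, which leads to the
   empty state. *)
all: try (destruct (classic (j = k)) as [->|Njk];
  [exists pempty; split; right;
   [apply (pstep_step F1' (r := q))|apply (pstep_step F0' (r := r))];
   (eapply pstep_eps; [|eassumption| |reflexivity]);
   subst; unfold premove, pupdate; rewrite ?pset_same; trivial;
   now rewrite !pset_other by congruence|]).
(* In the independent cases, each step leaves intact the local states that the other one reads. *)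
all: assert (Haq : a q = Some M)
  by (subst a; unfold premove, pupdate; now rewrite !pset_other by congruence).
all: assert (Hbr : b r = Some L)
  by (subst b; unfold premove, pupdate; now rewrite !pset_other by congruence).
all: try assert (Hak : a k = Some (LState rho' ups' (EVal w)))
  by (subst a; unfold premove, pupdate; now rewrite !pset_other by congruence).
all: try assert (Hbj : b j = Some (LState sigma' tau' (EVal v)))
  by (subst b; unfold premove, pupdate; now rewrite !pset_other by congruence).
all: eapply Hcommute;
  [first [ eapply pstep_local; [exact Haq|exact HM|reflexivity]
         | eapply pstep_fork; [exact Haq|exact HM|reflexivity]
         | eapply pstep_join; [exact Haq|exact HM|exact Hak|reflexivity] ]
  |first [ eapply pstep_local; [exact Hbr|exact HL|]
         | eapply pstep_fork; [exact Hbr|exact HL|]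
         | eapply pstep_join; [exact Hbr|exact HL|exact Hbj|] ]].
all: subst a b; extensionality z; unfold premove, pupdate, pset;
  repeat (destruct excluded_middle_informative; try congruence).
Qed.

(** * Uniqueness of normal forms *)

(** The invariant of executions that lets infinite identifier sets always supply fresh
    identifiers. *)
Definition finite_ids (s : Gstate) : Prop :=
  (exists rs, forall r, rid_gstate s r -> In r rs) /\
  (exists ls, forall l, lid_gstate s l -> In l ls).

Context (Rid_infinite : ~ Finite Rid) (Lid_infinite : ~ Finite Lid).

(** The extra pair to be avoided serves to keep clear of the identifiers allocated by a competing
    step. *)
Lemma fresh_exists s l1 r1 :
  finite_ids s -> exists l0 r0, fresh s l0 r0 /\ l0 <> l1 /\ r0 <> r1.
Proof.
intros [[rs Hrs] [ls Hls]].
destruct (infinite_fresh (r1 :: rs) Rid_infinite) as [r0 Hr0].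
destruct (infinite_fresh (l1 :: ls) Lid_infinite) as [l0 Hl0].
exists l0, r0; simpl in *; unfold fresh; intuition auto.
Qed.

Lemma step_at_pstep r s t :
  finite_ids s -> step_at subst r s t ->
  exists l0 r0, fresh s l0 r0 /\ pstep l0 r0 r s t.
Proof.
intros Hfin Ht.
(* [r1] and [l1] are arbitrary inhabitants that instantiate [fresh_exists]. The resulting [l0] and
   [r0] stand in for whatever the step does not allocate itself. *)
destruct (infinite_fresh nil Rid_infinite) as [r1 _].
destruct (infinite_fresh nil Lid_infinite) as [l1 _].
destruct (fresh_exists l1 r1 Hfin) as [l0 [r0 [[Fl Fr] _]]].
destruct Ht.
- exists l0, r0; split; [now split|].
  eapply pstep_local; eauto; constructor.
- exists l0, r0; split; [now split|].
  eapply pstep_local; eauto; constructor.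
- exists l0, r0; split; [now split|].
  eapply pstep_local; eauto; constructor.
- exists l, r0; split; [now split|].
  eapply pstep_local; eauto; constructor.
- exists l0, r0; split; [now split|].
  eapply pstep_local; eauto; econstructor; eassumption.
- exists l0, r0; split; [now split|].
  eapply pstep_local; eauto; now constructor.
- exists l0, r'; split; [now split|].
  eapply pstep_fork; eauto; constructor.
- exists l0, r0; split; [now split|].
  eapply pstep_join; eauto; constructor.
- exists l0, r0; split; [now split|].
  eapply pstep_eps; eauto; [constructor|].
  destruct (s r') as [M|] eqn:E0; trivial; elim H0; now exists M.
Qed.

Lemma finite_ids_step s t : finite_ids s -> step subst s t -> finite_ids t.
Proof.
intros Hfin [r Ht].
apply step_at_pstep in Ht as [l0 [r0 [_ Ht]]]; trivial.
destruct Hfin as [[rs Hrs] [ls Hls]]; split.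
- exists (r0 :: rs); intros x Hx; simpl.
  destruct (pstep_rid Ht Hx); auto.
- exists (l0 :: ls); intros x Hx; simpl.
  destruct (pstep_lid Ht Hx); auto.
Qed.

Lemma finite_ids_gequiv s t : finite_ids s -> gequiv s t -> finite_ids t.
Proof.
intros [[rs Hrs] [ls Hls]] [a [b [Ha [Hb <-]]]].
assert (Ha1 := Ha); destruct Ha1 as [a' [_ aa']].
assert (Hb1 := Hb); destruct Hb1 as [b' [_ bb']].
split.
- exists (map a rs); intros x Hx; rewrite <- (aa' x) in *.
  apply in_map, Hrs; now apply rid_ren_gstate in Hx.
- exists (map b ls); intros x Hx; rewrite <- (bb' x) in *.
  apply in_map, Hls; now apply lid_ren_gstate in Hx.
Qed.

(** Equivalence up to renaming is a simulation: the renamed step is again a step, because renaming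
    keeps its allocated identifiers fresh. *)
Lemma gequiv_step s t s' :
  finite_ids s -> gequiv s s' -> step subst s t ->
  exists t', step subst s' t' /\ gequiv t t'.
Proof.
intros Hfin [a [b [Ha [Hb <-]]]] [r Ht].
apply step_at_pstep in Ht as [l0 [r0 [[Fl Fr] Ht]]]; trivial.
exists (ren_gstate a b t); split; [|now exists a, b].
apply (pstep_ren Ha Hb) in Ht; apply (pstep_step (s := ren_gstate a b s)) in Ht;
  trivial.
split; intros Hx; [apply Fl; now apply lid_ren_gstate in Hx|].
apply Fr; now apply rid_ren_gstate in Hx.
Qed.

(** For a single revision, the first step is redone with the identifiers of the second, and
    determinism applies. For two revisions, [pstep_commute] applies once their allocations
    differ. *)
Lemma subcommutative s a b :
  finite_ids s -> step subst s a -> step subst s b ->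
  exists a' b', step_or_eq a a' /\ step_or_eq b b' /\ gequiv a' b'.
Proof.
intros Hfin [r Ha] [q Hb].
assert (Hfb : finite_ids b) by (eapply finite_ids_step; [exact Hfin|now exists q]).
apply step_at_pstep in Ha as [l0 [r0 [F0 Ha]]]; trivial.
apply step_at_pstep in Hb as [l1 [r1 [F1 Hb]]]; trivial.
destruct (classic (r = q)) as [<-|Nrq].
- destruct (pstep_refresh F0 F1 Ha) as [a' [Ha' Haa']].
  rewrite (pstep_det Ha' Hb) in Haa'.
  exists a, b; repeat split; trivial; now left.
(* Both steps may have allocated the same identifier, so the second is redone with a new pair, and
   the closing step is renamed back to [b]. *)
- destruct (fresh_exists l0 r0 Hfin) as [l2 [r2 [F2 [Nl Nr]]]].
  destruct (pstep_refresh F1 F2 Hb) as [b2 [Hb2 Hbb2]].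
  destruct (pstep_commute Nrq F0 F2 (not_eq_sym Nl) (not_eq_sym Nr) Ha Hb2)
    as [c [Hac [<-|Hbc]]].
  + exists b2, b; repeat split; trivial; [now left|now apply gequiv_sym].
  + apply gequiv_sym in Hbb2.
    assert (Hfb2 : finite_ids b2)
      by (eapply finite_ids_gequiv; [exact Hfb|now apply gequiv_sym]).
    destruct (gequiv_step Hfb2 Hbb2 Hbc) as [c' [Hbc' Hcc']].
    exists c, c'; repeat split; trivial; now right.
Qed.

Definition normal (s : Gstate) : Prop := ~ exists t, step subst s t.

Notation step_star := (clos_refl_trans_1n Gstate (step subst)).

Lemma finite_ids_steps s t : finite_ids s -> step_star s t -> finite_ids t.
Proof. intros Hs; induction 1; eauto using finite_ids_step. Qed.

Lemma gequiv_steps s t s' :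
  finite_ids s -> gequiv s s' -> step_star s t ->
  exists t', step_star s' t' /\ gequiv t t'.
Proof.
intros Hfin Heq Hst; revert s' Hfin Heq; induction Hst as [s|s u t Hsu Hut IH];
  intros s' Hfin Heq.
- exists s'; split; trivial; constructor.
- destruct (gequiv_step Hfin Heq Hsu) as [u' [Hs'u' Huu']].
  destruct (IH u' (finite_ids_step Hfin Hsu) Huu') as [t' [Hu't' Htt']].
  exists t'; split; trivial; econstructor; eassumption.
Qed.

Lemma normal_gequiv s t : finite_ids t -> gequiv s t -> normal s -> normal t.
Proof.
intros Hfin Heq Hs [u Hu]; apply Hs.
destruct (gequiv_step Hfin (gequiv_sym Heq) Hu) as [u' [Hu' _]]; now exists u'.
Qed.

(** Induction on the reduction to [t], closing its first step against the step to [a]. As [b'] is at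
    most one step from [b], the induction hypothesis reaches it; the reduction obtained is then
    transported to [a']. No termination argument is involved. *)
Lemma normal_form_after_step s t a :
  finite_ids s -> step_star s t -> normal t -> step subst s a ->
  exists t', step_star a t' /\ gequiv t t'.
Proof.
intros Hfin Hst Ht; revert a Hfin; induction Hst as [s|s b t Hsb Hbt IH];
  intros a Hfin Hsa; [elim Ht; now exists a|].
assert (Hfb := finite_ids_step Hfin Hsb).
destruct (subcommutative Hfin Hsa Hsb) as [a' [b' [Haa' [Hbb' Heq]]]].
apply gequiv_sym in Heq.
assert (Ht1 : exists t1, step_star b' t1 /\ gequiv t t1).
{ destruct Hbb' as [<-|Hbb']; [|now apply IH].
  exists t; split; trivial; apply gequiv_refl. }
destruct Ht1 as [t1 [Hbt1 Htt1]].
assert (Hfb' : finite_ids b')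
  by (destruct Hbb' as [<-|Hbb']; [|eapply finite_ids_step]; eassumption).
destruct (gequiv_steps Hfb' Heq Hbt1) as [t2 [Hat2 Ht12]].
exists t2; split; [|eapply gequiv_trans; eassumption].
destruct Haa' as [<-|Haa']; trivial; econstructor; eassumption.
Qed.

(** Induction on the reduction to [t']: after each of its steps, [t] is replaced by an equivalent
    normal form still reachable. *)
Lemma normal_form_unique s t t' :
  finite_ids s -> step_star s t -> normal t -> step_star s t' -> normal t' ->
  gequiv t t'.
Proof.
intros Hfin Hst Ht Hst' Ht'; revert t Hst Ht Hfin.
induction Hst' as [s|s a t' Hsa Hat' IH]; intros t Hst Ht Hfin.
- destruct Hst as [|u t Hu _]; [apply gequiv_refl|elim Ht'; now exists u].
- destruct (normal_form_after_step Hfin Hst Ht Hsa) as [t1 [Hat1 Heq]].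
  assert (Hfa := finite_ids_step Hfin Hsa).
  apply (gequiv_trans Heq), IH; trivial.
  apply (normal_gequiv (s := t)); trivial.
  exact (finite_ids_steps Hfa Hat1).
Qed.

(** * Initial states and evaluation *)

Lemma initial_state_finite_ids (e : Expr) s :
  program_expr e -> initial_state e s -> finite_ids s.
Proof.
intros [Hr Hl] [r ->]; split.
- exists (r :: nil); intros x Hx; left.
  apply rid_gstate_pset in Hx as [[_ ->]|[[L [[= <-] Hx]]|Hx]]; trivial.
  + destruct Hx as [Hx|[Hx|Hx]]; [now apply rid_store_pempty in Hx..|].
    now apply Hr in Hx.
  + destruct Hx as [[? ?]|[? [[? ?] _]]]; discriminate.
- exists nil; intros x Hx.
  apply lid_gstate_pset in Hx as [[L [[= <-] Hx]]|[? [[? ?] _]]]; [|discriminate].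
  destruct Hx as [Hx|[Hx|Hx]]; [now apply lid_store_pempty in Hx..|].
  now apply Hl in Hx.
Qed.

(** Swapping the two root identifiers suffices, since a program expression contains no revision
    identifier that the swap could change. *)
Lemma initial_state_gequiv (e : Expr) s s' :
  program_expr e -> initial_state e s -> initial_state e s' -> gequiv s s'.
Proof.
intros [Hr Hl] [r ->] [r' ->].
assert (Hid : Bijective (fun l : Lid => l)) by now exists (fun l => l).
exists (swap r r'), (fun l => l); repeat split; [apply swap_bij|trivial|].
unfold ren_gstate, pupdate; rewrite prename_pset, prename_pempty, swap_left
  by apply swap_bij; simpl.
rewrite ren_lstate_id_on; trivial; intros x Hx.
destruct Hx as [Hx|[Hx|Hx]]; [now apply rid_store_pempty in Hx..|].
now apply Hr in Hx.
Qed.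

(** The executions may start from different roots, so the first is transported to the initial state
    of the second before uniqueness of normal forms is applied. *)
Lemma evaluates_unique e s s' :
  program_expr e -> evaluates subst e s -> evaluates subst e s' -> gequiv s s'.
Proof.
intros He [s0 [Hi [Hs Hn]]] [s0' [Hi' [Hs' Hn']]].
apply clos_rt_rt1n in Hs, Hs'.
assert (Hf := initial_state_finite_ids He Hi).
assert (Hf' := initial_state_finite_ids He Hi').
destruct (gequiv_steps Hf (initial_state_gequiv He Hi Hi') Hs) as [t [Ht Heq]].
apply (gequiv_trans Heq), (normal_form_unique Hf'); trivial.
exact (normal_gequiv (finite_ids_steps Hf' Ht) Heq Hn).
Qed.

End Determinacy.

Theorem theorem5p10
  (Var Rid Lid : Type) (Const : constants)
  (subst : expr Var Rid Lid Const -> Var -> expr Var Rid Lid Const ->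
           expr Var Rid Lid Const)
  (subst_ren : forall (alpha : Rid -> Rid) (beta : Lid -> Lid) e x e',
     ren_expr alpha beta (subst e x e') =
     subst (ren_expr alpha beta e) x (ren_expr alpha beta e'))
  (subst_rid : forall e x e' r,
     rid_expr (subst e x e') r -> rid_expr e r \/ rid_expr e' r)
  (subst_lid : forall e x e' l,
     lid_expr (subst e x e') l -> lid_expr e l \/ lid_expr e' l)
  (Rid_infinite : ~ Finite Rid) (Lid_infinite : ~ Finite Lid)
  (e : expr Var Rid Lid Const) (e_program : program_expr e)
  (s s' : gstate Var Rid Lid Const) :
  evaluates subst e s -> evaluates subst e s' -> gequiv s s'.
Proof. now apply evaluates_unique. Qed.
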